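(* Let $\Pi:R_\ell\to\mathrm{Hom}(\mathcal H)$ be a GUS-rep over $\mathfrak g$ at level $\ell$ and let $A$ be a subgroup of $\mathcal R/n_c\mathcal R_a$. For every $e^H\in T_{\ell,0}$ and every $e^{H'}\in T_{\mathcal R}$, $$m_A(e^H)=m_A(e^{H+H'})=n_z\,m_{A,0}(e^H).$$ In particular, for $A$ the full root lattice $\mathcal R$, $$m_{\mathcal R,0}(e^H)=m_\Pi(e^H).$$
   Context: Lie theory. $\mathfrak g$ is a simple complex Lie algebra, the complexification of the Lie algebra of a simply connected compact Lie group $K$; $T\subset K$ is a maximal torus with Lie algebra $\mathfrak t$. Fix the invariant inner product $\langle\cdot,\cdot\rangle$, positive definite on $\mathfrak t$, and use it to regard roots and weights as elements of $\mathfrak t$; $r_+$ is the highest root, and the normalization is $\langle r_+,r_+\rangle=2$. Coroots are $H_r=2r/\langle r,r\rangle$. Elements of $T$ are written $e^H$, $H\in\mathfrak t$, where $e^{2\pi H}=1$ iff $H$ lies in the coroot lattice. $W$ is the Weyl group, acting on $\mathfrak t$ and on $T$ by $e^H\mapsto e^{\theta(H)}$; $\varepsilon(\theta)$ is the sign of $\theta\in W$; $\theta_r$ is the reflection in the root $r$. $\mathcal W$ is the weight lattice, $\mathcal R$ the root lattice, $Z(\mathfrak g)=\mathcal W/\mathcal R$, $n_z=|Z(\mathfrak g)|$. $\mathbf W_f$ is the set of fundamental weights, $\rho$ their sum. For a dominant weight $k$, $\chi_k$ is the character of the irreducible representation of $K$ with highest weight $k$, so $\chi_k(e^H)=\sum_s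 m_k(s)e^{i\langle s,H\rangle}$, the sum over the weights $s$ of the representation with multiplicities $m_k(s)$. Level. $\ell\in\mathbb N$, $n_c=c^\vee+\ell$ with $c^\vee$ the dual Coxeter number. $\mathcal R_a=\mathrm{span}_{\mathbb Z}\{\theta(r_+):\theta\in W\}\subset\mathcal R$, $\mathcal W_\ell=\mathcal W/n_c\mathcal R_a$. A subgroup $A$ of $\mathcal W_\ell$ is identified with the corresponding subgroup $n_c\mathcal R_a\subset A\subset\mathcal W$, and $T_A=\{e^{2\pi H}:H\in\mathfrak t,\ \langle r,H\rangle\in\mathbb Z\ \forall r\in A\}$; $T_\ell=T_{n_c\mathcal R_a}$. $T_{\ell,0}$ is the set of $e^H\in T_\ell$ with $e^{\theta_r(H)}\ne e^H$ for every root $r$. $\mathcal C_\ell$ is the set of $k=\sum_w k_w w\in\mathcal W$ ($w\in\mathbf W_f$) with all $k_w>0$ and $\langle k,H_{r_+}\rangle<n_c$. Verlinde ring. For $k\in\mathcal W_\ell$, $\tilde\chi_k$ is the function on $T_{\ell,0}$ given by $\tilde\chi_k(e^H)=\sum_{\theta\in W}\varepsilon(\theta)e^{i\langle\theta(k),H\rangle}$. $R_\ell$ is the fusion ring with $\mathbb Z$-basis $\{\tilde\chi_k\}_{k\in\mathcal C_\ell}$, multiplication $f\star g=fg/\tilde\chi_\rho$, identity $\tilde\chi_\rho$, and involution $\tilde\chi_k^*=\tilde\chi_{k^*}$, $k^*=\Omega(-k)$, where $\Omega\in W$ satisfies $\Omega(\rho)=-\rho$. Representations. A GUS-rep is a representation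 $\Pi:R_\ell\to\mathrm{Hom}(\mathcal H)$ on a finite-dimensional $Z(\mathfrak g)$-graded Hilbert space $\mathcal H=\bigoplus_{\kappa\in Z(\mathfrak g)}\mathcal H_\kappa$ with $\Pi(\tilde\chi_\rho)=I$, $\langle\Pi(\tilde\chi_j)v,v'\rangle=\langle v,\Pi(\tilde\chi_j^* )v'\rangle$, and $\Pi(\tilde\chi_j)\mathcal H_\kappa\subseteq\mathcal H_{\kappa+j-\rho}$. Write $\Pi_w=\Pi(\tilde\chi_{w+\rho})$, $w\in\mathbf W_f$. For $e^H\in T_\ell$, $m_\Pi(e^H)=\dim\{v\in\mathcal H:\Pi_wv=\chi_w(e^H)v\ \forall w\in\mathbf W_f\}$. Quantum root spaces. $L^2(\mathcal W_\ell)$ has basis of delta functions $\delta_k$, $k\in\mathcal W_\ell$. For $w\in\mathbf W_f$, $\Delta_w\delta_k=\sum_s m_w(s)\delta_{k+s}$ (sum over the weights $s$ of the irreducible representation of highest weight $w$). $\mathcal R_\Pi=\{f\in L^2(\mathcal W_\ell)\otimes\mathcal H:(\Delta_w\otimes I-I\otimes\Pi_w)f=0\ \forall w\in\mathbf W_f\}$ and $\mathcal R_{\Pi,0}=\mathcal R_\Pi\cap\bigoplus_{k\in\mathcal W_\ell}\mathbb C\delta_k\otimes\mathcal H_{-k}$ (the index $-k$ taken in $Z(\mathfrak g)$). Translations: $\vartheta_j\delta_k=\delta_{k-j}$, $\tilde\vartheta_j=\vartheta_j\otimes I$. $m_A(e^H)=\dim\{f\in\mathcal R_\Pi:\tilde\vartheta_jf=e^{-i\langle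 j,H\rangle}f\ \forall j\in A\}$ and, for $A\subset\mathcal R$, $m_{A,0}(e^H)=\dim\{f\in\mathcal R_{\Pi,0}:\tilde\vartheta_jf=e^{-i\langle j,H\rangle}f\ \forall j\in A\}$. *)

(* Defs.v *)
From HB Require Import structures.
From mathcomp Require Import all_boot all_order all_algebra.
From mathcomp Require Import complex finmap.
From mathcomp Require Import all_classical all_reals all_analysis.

Set Implicit Arguments.
Unset Strict Implicit.
Unset Printing Implicit Defensive.

Import Order.TTheory GRing.Theory Num.Theory.

Local Open Scope classical_set_scope.
Local Open Scope quotient_scope.
Local Open Scope complex_scope.
Local Open Scope ring_scope.

Inductive zspan (V : zmodType) (B : set V) : V -> Prop :=
| zspan0 : zspan B 0
| zspan_gen x : B x -> zspan B x
| zspanB x y : zspan B x -> zspan B y -> zspan B (x - y).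

Definition subgroup (V : zmodType) (A : set V) : Prop :=
  A 0 /\ forall x y, A x -> A y -> A (x - y).

Definition is_dim (F : fieldType) (V : lmodType F) (P : set V) (d : nat) :=
  exists b : 'I_d -> V,
    [/\ forall i, P (b i),
        forall c : 'I_d -> F, \sum_i c i *: b i = 0 -> forall i, c i = 0 &
        forall v, P v -> exists c : 'I_d -> F, v = \sum_i c i *: b i].

(* The dimension of a linear subspace P; 0 if P is infinite-dimensional. *)
Definition sdim (F : fieldType) (V : lmodType F) (P : set V) : nat :=
  xget 0%N [set d | is_dim P d].

Definition expi (R : realType) (x : R) : R[i] := (cos x +i* sin x).

Section Complexification.
Variable (R : realType).

(* The tensor product of V with C; (x, y) stands for x + i y. *)
Definition complexification (V : lmodType R) : Type := (V * V)%type.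

Section Lmod.
Variable V : lmodType R.
Local Notation VC := (complexification V).

HB.instance Definition _ := GRing.Zmodule.on VC.

Definition cplx_scale (z : R[i]) (x : VC) : VC :=
  (complex.Re z *: x.1 - complex.Im z *: x.2,
   complex.Im z *: x.1 + complex.Re z *: x.2).

Lemma cplx_scaleA a b x :
  cplx_scale a (cplx_scale b x) = cplx_scale (a * b) x.
Proof.
case: a b x => [a1 a2] [b1 b2] [x1 x2]; rewrite /cplx_scale /=.
congr pair; rewrite !(scalerDr, scalerN, scalerDl, scalerA, scalerBr, scaleNr).
  by rewrite opprD addrACA [in RHS]opprD; congr (_ + _); rewrite addrC.
rewrite addrACA; rewrite [X in X + _ = _]addrC [in RHS]addrC.
rewrite [a1 * b2 *: _ + _]addrC -addrA [in RHS]addrC.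
by rewrite !addrA; do 3 ?[rewrite addrAC; congr (_ + _)].
Qed.

Lemma cplx_scale1 : left_id 1 cplx_scale.
Proof.
by case=> x1 x2; rewrite /cplx_scale /= !scale1r !scale0r subr0 add0r.
Qed.

Lemma cplx_scaleDr : right_distributive cplx_scale +%R.
Proof.
move=> a [x1 x2] [y1 y2]; rewrite /cplx_scale /=.
by congr pair; rewrite /= !scalerDr ?opprD addrACA.
Qed.

Lemma cplx_scaleDl x : {morph cplx_scale^~ x : a b / a + b}.
Proof.
move=> [a1 a2] [b1 b2]; case: x => x1 x2; rewrite /cplx_scale /=.
by congr pair; rewrite /= !scalerDl ?opprD addrACA.
Qed.

HB.instance Definition _ := GRing.Zmodule_isLmodule.Build R[i] VC
  cplx_scaleA cplx_scale1 cplx_scaleDr cplx_scaleDl.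

Definition cplx_of (x : V) : VC := (x, 0).

Definition cplx_bracket (br : V -> V -> V) (x y : VC) : VC :=
  (br x.1 y.1 - br x.2 y.2, br x.1 y.2 + br x.2 y.1).

(* Simplicity of the complex Lie algebra obtained from (V, br). *)
Definition simple_complexification (br : V -> V -> V) : Prop :=
  (exists x y, cplx_bracket br x y <> 0) /\
  forall I : set VC,
    I 0 -> (forall a x y, I x -> I y -> I (a *: x + y)) ->
    (forall x y, I y -> I (cplx_bracket br x y)) ->
    I = [set 0] \/ I = setT.

End Lmod.
End Complexification.

(* The group K enters only through its Lie algebra, here the real Lie algebra
   [lie].  An invariant inner product together with the simplicity of the
   complexification characterizes the Lie algebras of the simply connected
   compact groups whose complexified Lie algebra is simple.  Maximal tori of K
   correspond to maximal abelian subalgebras. *)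
Record lieSetup (R : realType) := LieSetup {
  lie : vectType R;
  bracket : {bilinear lie -> lie -> lie};
  bracketxx : forall x, bracket x x = 0;
  bracket_jacobi : forall x y z,
    bracket x (bracket y z) + bracket y (bracket z x)
      + bracket z (bracket x y) = 0;
  lie_simple : simple_complexification (fun x y => bracket x y);
  ip : {dot lie for idfun};
  ip_invariant : forall x y z, ip (bracket x y) z = ip x (bracket y z);
  torus : {vspace lie};
  torus_abelian : forall x y, x \in torus -> y \in torus -> bracket x y = 0;
  torus_max : forall U : {vspace lie}, (torus <= U)%VS ->
    (forall x y, x \in U -> y \in U -> bracket x y = 0) -> U = torus }.

Section Roots.
Variables (R : realType) (S : lieSetup R).

Definition cartan : vectType R := subvs_of (torus S).

Definition rank : nat := \dim {:cartan}.

Definition ipt (x y : cartan) : R := ip S (vsval x) (vsval y).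

(* The element r of t stands for the linear form H |-> i <r, H>. *)
Definition is_root (r : cartan) : Prop :=
  r <> 0 /\ exists X : complexification (lie S), X <> 0 /\
    forall H : cartan,
      cplx_bracket (fun x y => bracket S x y) (cplx_of (vsval H)) X
        = ('i * (ipt r H)%:C) *: X.

Definition coroot (r : cartan) : cartan := (2 / ipt r r) *: r.

Definition reflection (r : cartan) : 'End(cartan) :=
  linfun (fun H => H - ipt r H *: coroot r).

Inductive weyl : 'End(cartan) -> Prop :=
| weyl1 : weyl \1%VF
| weylM r theta : is_root r -> weyl theta -> weyl (reflection r \o theta)%VF.

Lemma iptBl x y z : ipt (x - y) z = ipt x z - ipt y z.
Proof. by rewrite /ipt (linearB vsval) linearBl. Qed.
Lemma iptBr x y z : ipt x (y - z) = ipt x y - ipt x z.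
Proof. by rewrite /ipt (linearB vsval) linearB. Qed.
Lemma ipt0l z : ipt 0 z = 0.
Proof. by rewrite -(subrr z) iptBl subrr. Qed.
Lemma ipt0r z : ipt z 0 = 0.
Proof. by rewrite -[X in ipt _ X](subrr z) iptBr subrr. Qed.
Lemma iptZr a x z : ipt z (a *: x) = a * ipt z x.
Proof. by rewrite /ipt (linearZ_LR vsval) linearZ_LR. Qed.

Definition weight_pred : {pred cartan} :=
  fun x => `[< forall r, is_root r -> ipt x (coroot r) \is a Num.int >].

Lemma weight_closed : zmod_closed weight_pred.
Proof.
split=> [|x y /asboolP hx /asboolP hy]; apply/asboolP => r hr.
  by rewrite ipt0l.
by rewrite iptBl rpredB ?hx ?hy.
Qed.

HB.instance Definition _ :=
  GRing.isZmodClosed.Build cartan weight_pred weight_closed.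

Definition weight := {x : cartan | x \in weight_pred}.
HB.instance Definition _ := SubChoice.on weight.
HB.instance Definition _ := [SubChoice_isSubZmodule of weight by <:].

Definition rootlat : {pred weight} := fun x => `[< zspan is_root (val x) >].

Lemma rootlat_closed : zmod_closed rootlat.
Proof.
split=> [|x y /asboolP hx /asboolP hy]; apply/asboolP.
  by rewrite raddf0; exact: zspan0.
by rewrite raddfB; exact: zspanB.
Qed.

HB.instance Definition _ :=
  GRing.isZmodClosed.Build weight rootlat rootlat_closed.

(* Z(g), the quotient of the weight lattice by the root lattice. *)
Definition centerZ := {ideal_quot rootlat}.
HB.instance Definition _ := GRing.Zmodule.on centerZ.

Definition n_z : nat := #|` fset_set [set: centerZ]|.

Definition exp_ker : {pred cartan} := fun x =>
  `[< exists2 h, zspan [set coroot r | r in is_root] h & x = (2 * pi) *: h >].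

Lemma exp_ker_closed : zmod_closed exp_ker.
Proof.
split=> [|_ _ /asboolP[x hx ->] /asboolP[y hy ->]]; apply/asboolP.
  by exists 0; [exact: zspan0|rewrite scaler0].
by exists (x - y); [exact: zspanB|rewrite scalerBr].
Qed.

HB.instance Definition _ :=
  GRing.isZmodClosed.Build cartan exp_ker exp_ker_closed.

(* The maximal torus T, written additively, and the exponential map. *)
Definition maxtorus := {ideal_quot exp_ker}.
HB.instance Definition _ := GRing.Zmodule.on maxtorus.

Definition expT (H : cartan) : maxtorus := \pi_maxtorus H.

(* For a weight s, the character e^H |-> e^{i<s,H>} of T, see [charE]. *)
Definition char (s : cartan) (x : maxtorus) : R[i] := expi (ipt s (repr x)).

Lemma expi_periodic (x y : R) : y \is a Num.int ->
  expi (x + 2 * pi * y) = expi x.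
Proof.
have peri (z : R) (n : nat) : expi (z + 2 * pi * n%:R) = expi z.
  elim: n => [|n IH]; first by rewrite mulr0 addr0.
  rewrite -[n.+1%:R]natr1 mulrDr mulr1 addrA -IH; set y' := z + _.
  by rewrite /expi mulr_natl mulr2n addrA sinDpi cosDpi sinDpi cosDpi !opprK.
case/intrP => -[n|n] ->; first by rewrite -pmulrn peri.
rewrite NegzE mulrNz mulrN -(peri (x - _) n.+1) -pmulrn; congr expi.
by rewrite subrK.
Qed.

Lemma charE (s : weight) (H : cartan) :
  char (val s) (expT H) = expi (ipt (val s) H).
Proof.
have : repr (expT H) - H \in exp_ker.
  by rewrite Quotient.idealrBE reprK.
case/asboolP => h hh e; rewrite /char -(subrK H (repr _)) e addrC.
have -> : ipt (val s) (H + (2 * pi) *: h)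
    = ipt (val s) H + 2 * pi * ipt (val s) h.
  by rewrite -[_ *: h]opprK iptBr -scaleNr iptZr mulNr opprK.
apply: expi_periodic; elim: hh => [|_ [r hr <-]|x y _ hx _ hy].
- by rewrite ipt0r.
- by case: s => s /= /asboolP; apply.
- by rewrite iptBr rpredB.
Qed.

End Roots.

Arguments rootlat {R} S _.
Arguments weyl {R} S _.

(* A choice of simple roots, with the corresponding highest root, fundamental
   weights and longest Weyl group element. *)
Record rootSetup (R : realType) (S : lieSetup R) := RootSetup {
  simple : (rank S).-tuple (cartan S);
  simple_basis : basis_of fullv simple;
  simple_root : forall i, is_root (tnth simple i);
  root_simple : forall r, is_root r -> exists c : 'I_(rank S) -> nat,
    r = \sum_i tnth simple i *+ c i \/ r = - (\sum_i tnth simple i *+ c i);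
  rmax : cartan S;
  rmax_root : is_root rmax;
  rmax_highest : forall r, is_root r ->
    exists c : 'I_(rank S) -> nat,
      rmax - r = \sum_i tnth simple i *+ c i;
  rmax_norm : ipt rmax rmax = 2;
  fund : 'I_(rank S) -> weight S;
  fundE : forall i j,
    ipt (val (fund i)) (coroot (tnth simple j)) = (i == j)%:R;
  longest : 'End(cartan S);
  longest_weyl : weyl S longest;
  longestE : longest (val (\sum_i fund i)) = - val (\sum_i fund i) }.

Section Level.
Variables (R : realType) (S : lieSetup R) (D : rootSetup S).

Definition rho : weight S := \sum_i fund D i.

Definition weyl_sign (theta : 'End(cartan S)) : R :=
  \det (passmx.mxof (simple D) (simple D) theta).

(* The complex irreducible representation with highest weight w; [irr_act] is
   the action of the real Lie algebra of K. *)
Record irrep (w : cartan S) := Irrep {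
  irr_space : vectType R[i];
  irr_act : {linear lie S -> 'End(irr_space) | (@real_complex R) \; *:%R};
  irr_bracket : forall x y, irr_act (bracket S x y) =
    (irr_act x \o irr_act y)%VF - (irr_act y \o irr_act x)%VF;
  irr_neq0 : {:irr_space}%VS <> 0%VS;
  irr_irreducible : forall U : {vspace irr_space},
    (forall x, (irr_act x @: U <= U)%VS) -> U = 0%VS \/ U = fullv;
  irr_highest : exists v, v <> 0 /\
    forall H : cartan S, irr_act (vsval H) v = ('i * (ipt w H)%:C) *: v;
  irr_lower : forall (s : cartan S) v, v <> 0 ->
    (forall H : cartan S, irr_act (vsval H) v = ('i * (ipt s H)%:C) *: v) ->
    exists c : 'I_(rank S) -> nat,
      w - s = \sum_i tnth (simple D) i *+ c i }.

Section Multiplicities.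
Variables (w : cartan S) (V : irrep w).

(* Every weight of V belongs to the weight lattice. *)
Definition mult (s : weight S) : nat :=
  sdim [set v : irr_space V | forall H : cartan S,
    irr_act V (vsval H) v = ('i * (ipt (val s) H)%:C) *: v].

Definition weights : set (weight S) := [set s | (0 < mult s)%N].

Definition chi (x : maxtorus S) : R[i] :=
  \sum_(s \in weights) (mult s)%:R * char (val s) x.

End Multiplicities.

Definition T_ (A : set (weight S)) : set (maxtorus S) :=
  [set expT ((2 * pi) *: H) | H in
    [set H | forall r, A r -> ipt (val r) H \is a Num.int]].

Variable l : nat.

(* c^v + l, the dual Coxeter number c^v being 1 + <rho, H_{r_+}>. *)
Definition n_c : R := 1 + ipt (val rho) (coroot (rmax D)) + l%:R.

(* n_c R_a *)
Definition levlat : {pred weight S} := fun x =>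
  `[< exists2 y : cartan S,
        zspan [set theta (rmax D) | theta in weyl S] y &
        val x = n_c *: y >].

Lemma levlat_closed : zmod_closed levlat.
Proof.
split=> [|u v /asboolP[x hx e] /asboolP[y hy e']]; apply/asboolP.
  by exists 0; [exact: zspan0|rewrite scaler0 raddf0].
exists (x - y); [exact: zspanB|by rewrite raddfB scalerBr -e -e'].
Qed.

HB.instance Definition _ :=
  GRing.isZmodClosed.Build (weight S) levlat levlat_closed.

(* W_l, the quotient of the weight lattice by n_c R_a. *)
Definition Wlev := {ideal_quot levlat}.
HB.instance Definition _ := GRing.Zmodule.on Wlev.

Definition piW (k : weight S) : Wlev := \pi_Wlev k.

(* R / n_c R_a, as a subgroup of W_l. *)
Definition Rlev : set Wlev := [set piW r | r in [set r | r \in rootlat S]].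

Definition T_lev : set (maxtorus S) := T_ [set r | r \in levlat].

Definition T_lev0 : set (maxtorus S) :=
  [set expT H | H in [set H | T_lev (expT H) /\
    forall r, is_root r -> expT (reflection r H) <> expT H]].

Definition alcove : set (weight S) :=
  [set k | (exists2 c : 'I_(rank S) -> int,
              forall i, 0 < c i & k = \sum_i fund D i *~ c i) /\
           ipt (val k) (coroot (rmax D)) < n_c].

Definition Tfun := {x : maxtorus S | T_lev0 x} -> R[i].

(* For k a weight; it depends only on the class of k in W_l. *)
Definition tchi (k : cartan S) : Tfun := fun x =>
  \sum_(theta \in weyl S)
    (weyl_sign theta)%:C * char (theta k) (proj1_sig x).

Definition verlinde : set Tfun := zspan [set tchi (val k) | k in alcove].

Definition fusion (f g : Tfun) : Tfun := fun x =>
  f x * g x / tchi (val rho) x.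

(* Only the values of [gus_Pi] on the fusion ring [verlinde] matter.  The latter
   contains [tchi] of every weight: on T_{l,0} this function is 0 or, up to
   sign, the one of the weight of the alcove in the same affine Weyl orbit. *)
Record GUSrep := GUSRep {
  gus_space : vectType R[i];
  gus_dot : {dot gus_space for Num.conj};
  gus_grade : centerZ S -> {vspace gus_space};
  gus_grade_orth : forall a b u v, a <> b ->
    u \in gus_grade a -> v \in gus_grade b -> gus_dot u v = 0;
  gus_grade_full : exists s : seq (centerZ S),
    (\sum_(a <- s) gus_grade a)%VS = fullv;
  gus_Pi : Tfun -> 'End(gus_space);
  gus_PiB : forall f g, verlinde f -> verlinde g ->
    gus_Pi (f - g) = gus_Pi f - gus_Pi g;
  gus_PiM : forall f g, verlinde f -> verlinde g ->
    gus_Pi (fusion f g) = (gus_Pi f \o gus_Pi g)%VF;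
  gus_Pi1 : gus_Pi (tchi (val rho)) = \1%VF;
  gus_Pi_star : forall (j : weight S) u v,
    gus_dot (gus_Pi (tchi (val j)) u) v =
    gus_dot u (gus_Pi (tchi (longest D (- val j))) v);
  gus_Pi_grade : forall (j : weight S) a,
    (gus_Pi (tchi (val j)) @: gus_grade a
      <= gus_grade (a + \pi_(centerZ S) (j - rho))%R)%VS }.

Section QuantumRoots.
Variables (V : forall i, irrep (val (fund D i))) (P : GUSrep).

Definition Pi_fund i : 'End(gus_space P) :=
  gus_Pi P (tchi (val (fund D i + rho))).

Definition m_Pi (x : maxtorus S) : nat :=
  sdim [set v : gus_space P | forall i, Pi_fund i v = chi (V i) x *: v].

(* L^2(W_l) (x) H: the function f stands for the sum of the delta_k (x) f k. *)
Definition L2H := Wlev -> gus_space P.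
HB.instance Definition _ := GRing.Lmodule.on L2H.

Definition deltaH (k : Wlev) (v : gus_space P) : L2H :=
  fun k' => if k' == k then v else 0.

(* Delta_w (x) I *)
Definition Delta i (f : L2H) : L2H := fun k =>
  \sum_(s \in weights (V i)) (mult (V i) s)%:R *: f (k - piW s).

(* theta_j (x) I *)
Definition translation (j : Wlev) (f : L2H) : L2H := fun k => f (k + j).

Lemma Delta_delta i k v k' : Delta i (deltaH k v) k' =
  \sum_(s \in weights (V i)) ((mult (V i) s)%:R *: deltaH (k + piW s) v k').
Proof. by rewrite /Delta /deltaH; under eq_fsbigr do rewrite subr_eq. Qed.

Lemma translation_delta j k v :
  translation j (deltaH k v) = deltaH (k - j) v.
Proof. by apply/funext => k'; rewrite /translation /deltaH eq_sym -subr_eq eq_sym. Qed.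

Definition rootspace : set L2H :=
  [set f | forall i, Delta i f - (fun k => Pi_fund i (f k)) = 0].

Definition rootspace0 : set L2H :=
  [set f | rootspace f /\
    forall k : weight S, f (piW k) \in gus_grade P (- \pi_(centerZ S) k)].

Definition eigen (A : set Wlev) (x : maxtorus S) : set L2H :=
  [set f | forall j : weight S, A (piW j) ->
    translation (piW j) f = char (- val j) x *: f].

Definition m_A (A : set Wlev) (x : maxtorus S) : nat :=
  sdim (rootspace `&` eigen A x).

Definition m_A0 (A : set Wlev) (x : maxtorus S) : nat :=
  sdim (rootspace0 `&` eigen A x).

End QuantumRoots.
End Level.

Arguments Rlev {R S} D l _.
Arguments T_lev0 {R S} D l _.

(* Main.v *)
(* Let cl : W_l -> Z(g) be reduction modulo the root lattice.  All weights of the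
   fundamental representation V_w are congruent to w modulo R, so both Delta_w
   and Pi_w preserve the decomposition of L^2(W_l) (x) H according to the class
   kappa + cl k = const of delta_k (x) H_kappa.  The translations by elements of A
   preserve it too, since A is contained in R, and the translation by any weight
   of class kappa identifies the part of class kappa with the part of class 0.
   Hence the eigenspace for A consists of n_z copies of its class 0 part.  For
   A = R, a class 0 eigenvector f satisfies that e^{i<k,H>} f k depends only on
   cl k; summing these values over Z(g) gives a vector of H, and the equation
   Delta_w f = Pi_w f turns into Pi_w v = chi_w(e^H) v.

   The Lie-theoretic input is the integrality of <r, H_r'> for roots r, r': it
   gives n_c R_a <= R, so that cl is well defined, and the finiteness of Z(g). *)

Require Import Defs.
From HB Require Import structures.
From mathcomp Require Import all_boot all_order all_algebra.
From mathcomp Require Import complex finmap ring.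
From mathcomp Require Import all_classical all_reals all_analysis.

Set Implicit Arguments.
Unset Strict Implicit.
Unset Printing Implicit Defensive.

Import Order.TTheory GRing.Theory Num.Theory.

Local Open Scope classical_set_scope.
Local Open Scope quotient_scope.
Local Open Scope ring_scope.

(** * Dimensions of subspaces *)

Section Dimension.
Variable F : fieldType.
Implicit Types V W : lmodType F.

Definition is_subspace V (P : set V) : Prop :=
  P 0 /\ forall a x y, P x -> P y -> P (a *: x + y).

Lemma subspaceI V (P Q : set V) :
  is_subspace P -> is_subspace Q -> is_subspace (P `&` Q).
Proof. by move=> [P0 PD] [Q0 QD]; split=> // a x y [? ?] [? ?]; split; auto. Qed.

Lemma subspace_lincomb V (P : set V) (I : finType) (c : I -> F) (b : I -> V) :
  is_subspace P -> (forall i, P (b i)) -> P (\sum_i c i *: b i).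
Proof.
move=> [P0 PD] Pb; elim/big_rec: _ => // i x _ Px.
exact: PD.
Qed.

Definition independent V (I : finType) (b : I -> V) : Prop :=
  forall c : I -> F, \sum_i c i *: b i = 0 -> forall i, c i = 0.

(** A row relation of the coefficient matrix would be a relation among the [b i], so this matrix has
    rank [m], at most its number [d] of columns. *)
Lemma independent_leq V m d (b : 'I_m -> V) (e : 'I_d -> V) :
  independent b -> (forall i, exists c, b i = \sum_j c j *: e j) -> (m <= d)%N.
Proof.
move=> ib /choice[c bE].
pose M : 'M[F]_(m, d) := \matrix_(i, j) c i j.
suff /eqP <- : row_free M by exact: rank_leq_col.
apply: inj_row_free => v vM; apply/rowP => i; rewrite mxE.
apply: (ib (v 0)) => {i}; under eq_bigr do rewrite bE scaler_sumr.
rewrite exchange_big big1 //= => j _.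
have /rowP/(_ j) := vM; rewrite !mxE => vMj.
rewrite -[RHS](scale0r (e j)) -vMj scaler_suml; apply: eq_bigr => i _.
by rewrite mxE scalerA.
Qed.

Lemma is_dim_unique V (P : set V) d e : is_dim P d -> is_dim P e -> d = e.
Proof.
move=> [b [Pb ib sb]] [b' [Pb' ib' sb']]; apply/eqP; rewrite eqn_leq.
by rewrite (independent_leq ib (fun i => sb' _ (Pb i)))
  (independent_leq ib' (fun i => sb _ (Pb' i))).
Qed.

Lemma is_dim_sdim V (P : set V) d : is_dim P d -> sdim P = d.
Proof.
by move=> Pd; rewrite /sdim; case: xgetP => [e _ /is_dim_unique|/(_ d)]; exact.
Qed.

Lemma sdim_gt0 V (P : set V) :
  (0 < sdim P)%N -> exists v, P v /\ v != 0.
Proof.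
rewrite /sdim; case: xgetP => [d _ [b]|//]; case: d b => // d b [Pb ib _] _.
exists (b ord0); split=> //; apply/eqP => b0.
have s0 : \sum_i (i == ord0)%:R *: b i = 0.
  rewrite big1 // => i _; case: eqP => [->|_]; first by rewrite b0 scaler0.
  by rewrite scale0r.
by have /eqP := ib _ s0 ord0; rewrite eqxx oner_eq0.
Qed.

Lemma is_dim_finType V (P : set V) (I : finType) (b : I -> V) :
  (forall i, P (b i)) -> independent b ->
  (forall v, P v -> exists c, v = \sum_i c i *: b i) -> is_dim P #|I|.
Proof.
move=> Pb ib sb; exists (b \o enum_val); split=> [i|c c0 i|v /sb[c ->]] /=.
- exact: Pb.
- rewrite -(enum_valK i); apply: (ib (c \o enum_rank)) => /=.
  rewrite -[RHS]c0 (reindex _ (onW_bij _ (@enum_val_bij I))) /=.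
  by apply: eq_bigr => j _; rewrite enum_valK.
- by exists (c \o enum_val); rewrite (reindex _ (onW_bij _ (@enum_val_bij I))).
Qed.

(** A longest independent family in [Q] exists, its length being bounded by [d]; it spans [Q], as a
    vector outside its span would extend it. *)
Lemma is_dim_sub V (P Q : set V) d :
  is_subspace Q -> Q `<=` P -> is_dim P d -> exists e, is_dim Q e.
Proof.
move=> sQ QP [b [Pb ib sb]].
pose good m := `[< exists b' : 'I_m -> V, (forall i, Q (b' i)) /\ independent b' >].
have good_le m : good m -> (m <= d)%N.
  by case/asboolP => b' [Qb' ib']; apply: (independent_leq ib') => i; exact/sb/QP.
have good0 : exists m, good m.
  exists 0%N; apply/asboolP; exists (fun _ => 0).
  by split=> [[]|c _ []].
case: (ex_maxnP good0 good_le) => m /asboolP[b' [Qb' ib']] max_m.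
exists m, b'; split=> // v Qv.
pose b1 (i : 'I_m.+1) := oapp b' v (unlift ord0 i).
have Qb1 i : Q (b1 i) by rewrite /b1; case: (unlift _ _).
have : ~ independent b1.
  move=> ib1; have /max_m : good m.+1 by apply/asboolP; exists b1.
  by rewrite ltnn.
move=> /existsNP[c /not_implyP[c0 /existsNP[i /eqP ci]]].
have {}c0 : c ord0 *: v + \sum_(j < m) c (lift ord0 j) *: b' j = 0.
  rewrite -[RHS]c0 big_ord_recl {1}/b1 unlift_none /=.
  by congr (_ + _); apply: eq_bigr => j _; rewrite /b1 liftK.
have [cz|cn] := eqVneq (c ord0) 0; last first.
  exists (fun i => - (c ord0)^-1 * c (lift ord0 i)).
  apply: (scalerI cn); rewrite scaler_sumr; move/eqP: c0.
  rewrite addr_eq0 => /eqP ->; rewrite -sumrN; apply: eq_bigr => j _.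
  by rewrite scalerA mulrA mulrN divff // mulN1r scaleNr.
rewrite cz scale0r add0r in c0; have /= c0' := ib' _ c0.
by move: ci; case: (unliftP ord0 i) => [j|] ->; rewrite ?c0' ?cz eqxx.
Qed.

Lemma is_dim_image V W (P : set V) (Q : set W) (f : {linear V -> W}) d :
  is_subspace P -> (forall x, P x -> f x = 0 -> x = 0) ->
  f @` P = Q -> is_dim P d -> is_dim Q d.
Proof.
move=> sP fI <- [b [Pb ib sb]]; exists (f \o b); split=> [i|c c0|_ [x /sb[c ->] <-]].
- by exists (b i).
- apply: ib; apply: fI; first exact: subspace_lincomb.
  by rewrite linear_sum -[RHS]c0; apply: eq_bigr => i _; rewrite linearZ.
- exists c; rewrite linear_sum; apply: eq_bigr => i _.
  by rewrite linearZ.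
Qed.

Lemma sdim_eq V W (P : set V) (Q : set W) :
  (forall d, is_dim P d <-> is_dim Q d) -> sdim P = sdim Q.
Proof.
move=> PQ; rewrite /sdim; congr xget.
by apply/seteqP; split=> d /= /PQ.
Qed.

Lemma sdim_iso V W (P : set V) (Q : set W)
    (f : {linear V -> W}) (g : {linear W -> V}) :
  is_subspace P -> is_subspace Q ->
  (forall x, P x -> Q (f x)) -> (forall y, Q y -> P (g y)) ->
  (forall x, P x -> g (f x) = x) -> (forall y, Q y -> f (g y) = y) ->
  sdim P = sdim Q.
Proof.
move=> sP sQ fP gQ gf fg; apply: sdim_eq => d; split.
  apply: (is_dim_image (f := f)) => //.
    by move=> x /gf {2}<- ->; rewrite linear0.
  apply/seteqP; split=> [_ [x Px <-]|y Qy]; first exact: fP.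
  by exists (g y); [exact: gQ|exact: fg].
apply: (is_dim_image (f := g)) => //.
  by move=> y /fg {2}<- ->; rewrite linear0.
apply/seteqP; split=> [_ [y Qy <-]|x Px]; first exact: gQ.
by exists (f x); [exact: fP|exact: gf].
Qed.

(* The family [u i] exhibits [P] as a direct sum of [#|I|] copies of [P0], the
   [q i] being the coordinates. *)
Lemma sdim_copies V (P P0 : set V) (I : finType)
    (u q : I -> {linear V -> V}) :
  is_subspace P -> is_subspace P0 -> (0 < #|I|)%N ->
  (forall i x, P0 x -> P (u i x)) -> (forall i x, P x -> P0 (q i x)) ->
  (forall i j x, P0 x -> q j (u i x) = if i == j then x else 0) ->
  (forall x, P x -> x = \sum_i u i (q i x)) ->
  sdim P = (#|I| * sdim P0)%N.
Proof.
move=> sP sP0 /card_gt0P[i0 _] uP qP qu Pq.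
have dimP d : is_dim P0 d -> is_dim P (#|I| * d)%N.
  move=> [b [Pb ib sb]]; rewrite -[d]card_ord -card_prod.
  apply: (@is_dim_finType _ _ _ (fun p : I * 'I_d => u p.1 (b p.2))).
  - by move=> p; exact: uP.
  - move=> c c0 [i j].
    have {}c0 : \sum_i \sum_j c (i, j) *: u i (b j) = 0.
      by rewrite pair_bigA -[RHS]c0; apply: eq_bigr => -[].
    (* Applying [q i] to the relation keeps only the terms of the [i]-th copy. *)
    apply: (ib (fun j => c (i, j))) => {j}.
    have := congr1 (q i) c0; rewrite linear0 => {2}<-.
    rewrite linear_sum (bigD1 i) //= [X in _ + X]big1 => [|k ki].
      rewrite addr0 linear_sum; apply: eq_bigr => j _.
      by rewrite linearZ /= qu // eqxx.
    rewrite linear_sum big1 // => j _.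
    by rewrite linearZ /= qu // (negPf ki) scaler0.
  - move=> v Pv; have /choice[c cE] i : exists c : 'I_d -> F, q i v = \sum_j c j *: b j.
      by apply: sb; exact: qP.
    exists (fun p => c p.1 p.2); rewrite {1}(Pq v Pv).
    rewrite -(pair_bigA _ (fun i j => c i j *: u i (b j))) /=.
    apply: eq_bigr => i _; rewrite cE linear_sum.
    by apply: eq_bigr => j _; rewrite linearZ.
have [[d P0d]|nP0] := pselect (exists d, is_dim P0 d).
  by rewrite (is_dim_sdim P0d) (is_dim_sdim (dimP _ P0d)).
(* With [P0] infinite-dimensional the right side is 0 by convention. If [P] had a dimension, so
   would the copy of [P0] under [u i0], which [q i0] maps back onto [P0]. *)
rewrite /sdim; case: xgetP => [e _ Pe|_]; last first.
  by case: xgetP => [d _ P0d|]; [case: nP0; exists d|rewrite muln0].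
case: nP0; have [||d ud] := @is_dim_sub _ P (u i0 @` P0) e _ _ Pe.
- split; first by exists 0; rewrite ?linear0 //; case: sP0.
  move=> a _ _ [x Px <-] [y Py <-].
  by exists (a *: x + y); rewrite ?linearP //; case: sP0 => _; exact.
- by move=> _ [x Px <-]; exact: uP.
exists d; apply: (is_dim_image (f := q i0)) ud.
- split; first by exists 0; rewrite ?linear0 //; case: sP0.
  move=> a _ _ [x Px <-] [y Py <-].
  by exists (a *: x + y); rewrite ?linearP //; case: sP0 => _; exact.
- by move=> _ [x Px <-]; rewrite qu // eqxx => ->; rewrite linear0.
apply/seteqP; split=> [_ [_ [x Px <-] <-]|x Px]; first by rewrite qu // eqxx.
by exists (u i0 x); [exists x|rewrite qu // eqxx].
Qed.

End Dimension.

(** * Eigenvalues of sl2-triples *)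

Section Eigenvectors.
Variables (F : fieldType) (V : vectType F) (I : Type) (T : I -> 'End(V)).
Variables (J : eqType) (ev : J -> I -> F).
Hypothesis ev_inj : forall j k, (forall i, ev j i = ev k i) -> j = k.

(** For [j] in the tail, choose [i] at which the eigenvalues of [j] and of the head [k] differ;
    [T i - ev k i] kills [v k] and rescales the other terms, so induction applies. *)
Lemma joint_eigen_sum_eq0 (v : J -> V) (s : seq J) : uniq s ->
  (forall j i, j \in s -> T i (v j) = ev j i *: v j) ->
  \sum_(j <- s) v j = 0 -> forall j, j \in s -> v j = 0.
Proof.
elim: s v => [//|k s IH] v /= /andP[ks us] Tv.
rewrite big_cons => v0.
have vs j : j \in s -> v j = 0.
  move=> js; have /existsNP[i /eqP evN] : ~ forall i, ev j i = ev k i.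
    by move=> /ev_inj jk; rewrite -jk js in ks.
  suff : (ev j i - ev k i) *: v j = 0.
    by move/eqP; rewrite scaler_eq0 subr_eq0 (negPf evN) => /eqP.
  apply: (IH (fun j => (ev j i - ev k i) *: v j)) js => //.
    by move=> h i' hs; rewrite linearZ /= Tv ?inE ?hs ?orbT // !scalerA mulrC.
  have := congr1 (fun x => T i x - ev k i *: x) v0.
  rewrite /= linear0 scaler0 subr0 linearD /= Tv ?mem_head // linear_sum scalerDr.
  rewrite opprD addrACA subrr add0r => {2}<-.
  rewrite scaler_sumr -sumrB; apply: eq_big_seq => h hs.
  by rewrite /= Tv ?inE ?hs ?orbT // scalerBl.
move=> j; rewrite inE => /orP[/eqP ->|/vs //]; rewrite -[RHS]v0 big_seq.
by rewrite big1 ?addr0 // => h /vs.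
Qed.

End Eigenvectors.

Lemma joint_eigen_card (F : fieldType) (V : vectType F) (I : Type) (T : I -> 'End(V))
    (J : finType) (ev : J -> I -> F) (v : J -> V) :
  (forall j k, (forall i, ev j i = ev k i) -> j = k) ->
  (forall j i, T i (v j) = ev j i *: v j) -> (forall j, v j != 0) ->
  (#|J| <= \dim {:V})%N.
Proof.
move=> ev_inj Tv vN.
apply: (@independent_leq F V #|J| (\dim {:V}) (v \o enum_val)
  (fun j => (vbasis {:V})`_j)) => [c c0 i|i].
  suff /eqP : c i *: v (enum_val i) = 0.
    by rewrite scaler_eq0 (negPf (vN _)) orbF => /eqP.
  apply: (@joint_eigen_sum_eq0 F V I T 'I_#|J| (ev \o enum_val) _
    (fun i => c i *: v (enum_val i)) (index_enum _) (index_enum_uniq _)) => //.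
  - by move=> j k jk; apply: enum_val_inj; apply: ev_inj.
  - by move=> j h _ /=; rewrite linearZ /= Tv !scalerA mulrC.
  - by rewrite mem_index_enum.
exists (fun j => coord (vbasis {:V}) j (v (enum_val i))).
exact/coord_vbasis/memvf.
Qed.

(** * Integrality of the eigenvalues of [h] *)

Section Sl2.
Variables (F : archiNumFieldType) (V : vectType F) (e f h : 'End(V)).
Hypothesis he : forall v, h (e v) - e (h v) = 2 *: e v.
Hypothesis hf : forall v, h (f v) - f (h v) = - 2 *: f v.
Hypothesis ef : forall v, e (f v) - f (e v) = h v.

(** Nonzero iterates of [g] on [v] are eigenvectors of [h] for the distinct eigenvalues [a + k c],
    so some iterate vanishes; the last nonzero one is the vector sought. *)
Lemma raising_nilpotent (g : 'End(V)) (c a : F) v : c != 0 ->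
  (forall v, h (g v) - g (h v) = c *: g v) -> h v = a *: v -> v != 0 ->
  exists n, iter n g v != 0 /\ g (iter n g v) = 0.
Proof.
move=> c0 hg hv v0; pose n := (\dim {:V}).+1.
have hiter k : h (iter k g v) = (a + k%:R * c) *: iter k g v.
  elim: k => [|k IH]; first by rewrite mul0r addr0.
  have /eqP := hg (iter k g v); rewrite subr_eq IH linearZ /= => /eqP ->.
  by rewrite -scalerDl -natr1; congr (_ *: _); ring.
have [m gm0] : exists m, iter m g v == 0.
  apply: contrapT => /forallNP N.
  suff : (n <= \dim {:V})%N by rewrite ltnn.
  rewrite -[n]card_ord.
  apply: (@joint_eigen_card _ V unit (fun _ => h) _ (fun (j : 'I_n) _ => a + j%:R * c)
    (fun j => iter j g v)) => // [j k /(_ tt)|j]; last exact/negP/N.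
  move/addrI/(mulIf c0)/eqP; rewrite eqr_nat => /eqP jk; exact: val_inj.
have ex : exists m, iter m g v == 0 by exists m.
case: (ex_minnP ex) => -[|p] /= /eqP gp min_p; first by rewrite gp eqxx in v0.
by exists p; split=> //; apply/negP => /min_p; rewrite ltnn.
Qed.

(** Raise [v] to a vector [w] killed by [e], of eigenvalue [b = a + 2n], then lower [w] to the last
    nonzero [f^m w]. From [e f^(m+1) w = (m+1)(b - m) f^m w] follows [b = m], hence [a = m - 2n]. *)
Lemma sl2_eigenvalue_int (a : F) v : h v = a *: v -> v != 0 -> a \is a Num.int.
Proof.
move=> hv v0; have two0 : (2 : F) != 0 by rewrite pnatr_eq0.
have [n [en0 een0]] := raising_nilpotent two0 he hv v0.
set w := iter n e v in en0 een0; set b := a + n%:R * 2.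
have hw : h w = b *: w.
  rewrite /w /b; elim: n {en0 een0 w b} => [|n IH]; first by rewrite mul0r addr0.
  have /eqP := he (iter n e v); rewrite subr_eq IH linearZ /= => /eqP ->.
  by rewrite -scalerDl -natr1; congr (_ *: _); ring.
have m20 : (- 2 : F) != 0 by rewrite oppr_eq0.
have [m [fm0 ffm0]] := raising_nilpotent m20 hf hw en0.
have hfw k : h (iter k f w) = (b - k%:R * 2) *: iter k f w.
  elim: k => [|k IH]; first by rewrite mul0r subr0.
  have /eqP := hf (iter k f w); rewrite subr_eq IH linearZ /= => /eqP ->.
  by rewrite -scalerDl -natr1; congr (_ *: _); ring.
have efw k : e (iter k.+1 f w) = (k.+1%:R * (b - k%:R)) *: iter k f w.
  elim: k => [|k IH].
    have /eqP := ef w; rewrite een0 linear0 subr0 hw => /eqP /= ->.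
    by rewrite mul1r subr0.
  have /eqP := ef (iter k.+1 f w); rewrite subr_eq IH hfw linearZ /= => /eqP ->.
  rewrite -scalerDl; congr (_ *: _).
  by rewrite -[k.+2%:R]natr1 -[k.+1%:R]natr1; ring.
have : m.+1%:R * (b - m%:R) == 0.
  have /esym/eqP := efw m; rewrite /= ffm0 linear0 scaler_eq0.
  by rewrite (negPf fm0) orbF.
rewrite mulf_eq0 pnatr_eq0 /= subr_eq0 /b -subr_eq0 -addrA addr_eq0 => /eqP ->.
by rewrite rpredN rpredB ?rpredM ?rpred_nat.
Qed.

End Sl2.

(** * Integrality of the Cartan numbers *)

Section CartanIntegers.
Variables (R : realType) (S : lieSetup R).
Notation L := (lie S).
Notation br := (bracket S).
Implicit Types (x y z : L) (r H : cartan S).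

Lemma bracketC x y : br x y = - br y x.
Proof.
apply/eqP; rewrite -addr_eq0; have := bracketxx (x + y).
by rewrite linearDl !linearDr !bracketxx add0r addr0 => ->.
Qed.

Lemma bracket_bracket x y z : br (br x y) z = br x (br y z) - br y (br x z).
Proof.
have /eqP := bracket_jacobi x y z.
rewrite (bracketC z (br x y)) subr_eq0 => /eqP <-.
by rewrite (bracketC z x) linearNr.
Qed.

(* The adjoint action of [x + i y] on the complexification, seen as a real
   vector space. *)
Definition adC x y (p : L * L) : L * L :=
  (br x p.1 - br y p.2, br x p.2 + br y p.1).

Lemma adC_linear x y : linear (adC x y).
Proof.
move=> a [u1 u2] [v1 v2]; rewrite /adC /=; congr pair.
  by rewrite /= !linearPr /= scalerBr opprD addrACA.
by rewrite /= !linearPr /= scalerDr addrACA.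
Qed.
HB.instance Definition _ x y := GRing.isLinear.Build R (L * L)%type (L * L)%type _
  (adC x y) (adC_linear x y).

Lemma adC_comm x y x' y' p :
  adC x y (adC x' y' p) - adC x' y' (adC x y p)
    = adC (br x x' - br y y') (br x y' + br y x') p.
Proof.
case: p => u v; rewrite /adC /=; congr pair => /=;
  rewrite /= !(linearBl, linearDl, linearBr, linearDr) /= !bracket_bracket;
  by rewrite !opprD !opprK !addrA [LHS](ACl (1*5*4*8*2*7*3*6)).
Qed.

Lemma adCZ a x y p : adC (a *: x) (a *: y) p = a *: adC x y p.
Proof.
case: p => u v; rewrite /adC /=; congr pair => /=.
  by rewrite !linearZl_LR scalerBr.
by rewrite !linearZl_LR scalerDr.
Qed.

Lemma iptC r H : ipt r H = ipt H r.
Proof. by rewrite /ipt hermC expr0 mul1r. Qed.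

Lemma iptZl a r H : ipt (a *: r) H = a * ipt r H.
Proof. by rewrite iptC iptZr iptC. Qed.

Lemma iptDr r H H' : ipt r (H + H') = ipt r H + ipt r H'.
Proof. by rewrite /ipt (linearD vsval) linearDr. Qed.

Lemma iptDl r r' H : ipt (r + r') H = ipt r H + ipt r' H.
Proof. by rewrite iptC iptDr !(iptC H). Qed.

Lemma ipt_gt0 r : r <> 0 -> 0 < ipt r r.
Proof. by move=> /eqP r0; rewrite neq0_dnorm_gt0. Qed.

Lemma cplx_scaleiE (c : R) (X : complexification L) :
  ('i * c%:C%C) *: X = (- (c *: X.2), c *: X.1).
Proof.
rewrite -complexiE; case: X => x y; congr pair; rewrite /= !mul0r mulr0 mul1r.
  by rewrite subrr scale0r !add0r.
by rewrite add0r subrr scale0r addr0.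
Qed.

(** Real and imaginary parts of [[H, x + iy] = i <r,H> (x + iy)]. *)
Lemma is_rootP r : is_root r -> exists x y, [/\ (x, y) <> 0,
  forall H, br (vsval H) x = - ipt r H *: y & forall H, br (vsval H) y = ipt r H *: x].
Proof.
case=> _ [[x y] [X0 rX]]; exists x, y.
have {}rX H : br (vsval H) x = - (ipt r H *: y) /\ br (vsval H) y = ipt r H *: x.
  have := rX H; rewrite cplx_scaleiE /cplx_bracket /= !linear0l subr0 addr0.
  by case=> -> ->.
by split=> // H; have [rx ry] := rX H; rewrite ?rx ?ry ?scaleNr.
Qed.

(** Adjoining [z] to the torus gives an abelian subspace, so maximality applies. *)
Lemma torus_centralizer z : (forall H, br (vsval H) z = 0) -> z \in torus S.
Proof.
move=> Hz; have tz x : x \in torus S -> br x z = 0.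
  by move=> xt; rewrite -(vsprojK xt).
rewrite -(@torus_max _ S (torus S + <[z]>)%VS); last 2 first.
- exact: addvSl.
- move=> x y /memv_addP[x1 tx1 [x2 /vlineP[a ->] ->]].
  move=> /memv_addP[y1 ty1 [y2 /vlineP[b ->] ->]].
  rewrite linearDl !linearDr !linearZl_LR !linearZr_LR /=.
  by rewrite bracketxx (torus_abelian tx1 ty1) (bracketC z) !tz // oppr0 !scaler0 !addr0.
- by rewrite -{1}[z]add0r memv_add ?mem0v ?memv_line.
Qed.

(** For a root vector [x + iy] put [n = <x,x>]. The bracket [[x,y]] commutes with the torus, hence
    lies in it, and invariance gives [<[x,y],H> = -n <r,H>] for all [H]. *)
Lemma root_triple r : is_root r -> exists x y (n : R), [/\ 0 < n,
  br x y = - n *: vsval r, br (vsval r) x = - ipt r r *: y &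
  br (vsval r) y = ipt r r *: x].
Proof.
move=> rr; have [x [y [X0 rx ry]]] := is_rootP rr.
have r0 : 0 < ipt r r by apply: ipt_gt0; case: rr.
have n0 : 0 < ip S x x.
  apply: neq0_dnorm_gt0; apply/eqP => x0; apply: X0; rewrite x0; congr pair.
  have /esym/eqP := rx r; rewrite x0 linear0r scaler_eq0 oppr_eq0.
  by rewrite (gt_eqF r0) => /eqP.
exists x, y, (ip S x x); split=> //.
have zt : br x y \in torus S.
  apply: torus_centralizer => H; have := bracket_bracket (vsval H) x y.
  rewrite rx ry linearZl_LR linearZr_LR /= !bracketxx !scaler0 subr0.
  by move=> /esym.
rewrite -(vsprojK zt) -(linearZ_LR vsval); congr (vsval _).
set Z := vsproj _ _.
have ZH H : ipt Z H = - ip S x x * ipt r H.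
  rewrite /ipt vsprojK //.
  rewrite ip_invariant bracketC linearNr ry linearZr_LR /=.
  by rewrite mulNr mulrC.
apply/eqP; rewrite -subr_eq0; apply/negPn/negP => /eqP/ipt_gt0.
by rewrite iptBl ZH iptZl subrr ltxx.
Qed.

(* [sl2_eigenvalue_int] applied to the adjoint action of the triple
   [X = x + i y], a multiple of its conjugate, and [- 2 i r / <r, r>]. *)
Lemma root_weight r : is_root r -> r \in @weight_pred R S.
Proof.
move=> rr; apply/asboolP => r' rr'.
have [x [y [n [n0 xy rx ry]]]] := root_triple rr'.
have c0 : 0 < ipt r' r' by apply: ipt_gt0; case: rr'.
set c := ipt r' r' in c0 rx ry *.
have [u [v [uv0 ru rv]]] := is_rootP rr.
(* Put [E = x + iy], [F = -k (x - iy)] and [h = i b r']. The value of [b] gives [[h,E] = 2E], that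
   of [k] gives [[E,F] = h]; on the root vector [u + iv], [h] has eigenvalue [-b <r',r>], which is
   [<r, coroot r'>]. *)
pose k := (n * c)^-1; pose b := - (2 / c).
have cN0 := lt0r_neq0 c0; have nN0 := lt0r_neq0 n0.
have bc : b * c = - 2 by rewrite /b mulNr divfK.
apply: (@sl2_eigenvalue_int _ _ (linfun (adC x y)) (linfun (adC (- k *: x) (k *: y)))
  (linfun (adC 0 (b *: vsval r'))) _ _ _ _ (u, v)) => [w|w|w||].
- rewrite !lfunE /= adC_comm -adCZ !linear0l sub0r add0r !linearZl_LR rx ry /=.
  by rewrite !scalerA -scaleNr mulrN bc opprK.
- rewrite !lfunE /= adC_comm -adCZ !linear0l sub0r add0r !linearZl_LR !linearZr_LR /=.
  rewrite rx ry !scalerA /= -scaleNr -bc.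
  by congr (adC _ _ w); congr (_ *: _); ring.
- rewrite !lfunE /= adC_comm !linearZr_LR !bracketxx !scaler0 subr0 /=.
  rewrite (bracketC y) scaleNr scalerN opprK -scalerDl xy scalerA.
  by congr (adC _ _ w); congr (_ *: _); rewrite /b /k; field; rewrite cN0 nN0.
- rewrite lfunE /= /adC !linear0l !sub0r !add0r !linearZl_LR ru rv /= !scalerA.
  rewrite -scaleNr /coroot iptZr -/c /b; congr pair; rewrite /= ?mulrN ?mulNr ?opprK //.
- exact/eqP.
Qed.

Lemma root_coroot_int r r' : is_root r -> is_root r' -> ipt r (coroot r') \is a Num.int.
Proof. by move=> /root_weight/asboolP; exact. Qed.

Lemma zspan_int (B : set (cartan S)) (x : cartan S) (m : int) :
  zspan B x -> zspan B (x *~ m).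
Proof.
move=> Bx; have Bn (n : nat) : zspan B (x *- n).
  elim: n => [|n IH]; first by rewrite mulr0n oppr0; exact: zspan0.
  by rewrite mulrSr opprD; apply: zspanB.
case: m => n; last by rewrite NegzE mulrNz; exact: Bn.
by rewrite -[_ *~ _]opprK -[- - _]sub0r; apply: zspanB; [exact: zspan0|exact: Bn].
Qed.

Lemma zspanD (B : set (cartan S)) (x y : cartan S) :
  zspan B x -> zspan B y -> zspan B (x + y).
Proof.
by move=> Bx By; rewrite -[y]opprK -[- y]sub0r; do !apply: zspanB => //; exact: zspan0.
Qed.

Lemma reflection_linear r : linear (fun H => H - ipt r H *: coroot r).
Proof.
move=> a u v; rewrite iptDr iptZr scalerDl opprD addrACA scalerBr.
by rewrite (scalerA a).
Qed.

Lemma reflectionE r H : reflection r H = H - ipt H (coroot r) *: r.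
Proof.
pose f : {linear cartan S -> cartan S} := HB.pack (fun H => H - ipt r H *: coroot r)
  (GRing.isLinear.Build _ _ _ _ _ (reflection_linear r)).
rewrite -[reflection r]/(linfun f) lfunE /= /coroot iptZr scalerA.
by rewrite iptC mulrC.
Qed.

Lemma zspan_root_coroot_int (x : cartan S) r : zspan (@is_root R S) x -> is_root r ->
  ipt x (coroot r) \is a Num.int.
Proof.
move=> + rr; elim=> {x} [|x rx|x y _ hx _ hy]; first by rewrite ipt0l.
  exact: root_coroot_int.
by rewrite iptBl rpredB.
Qed.

Lemma zspan_reflection r (x : cartan S) : is_root r ->
  zspan (@is_root R S) x -> zspan (@is_root R S) (reflection r x).
Proof.
move=> rr zx; rewrite reflectionE.
have /intrP[m ->] := zspan_root_coroot_int zx rr.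
by rewrite scaler_int; apply: zspanB => //; apply: zspan_int; exact: zspan_gen.
Qed.

Lemma zspan_weyl theta (x : cartan S) : weyl S theta ->
  zspan (@is_root R S) x -> zspan (@is_root R S) (theta x).
Proof.
move=> + zx; elim=> {theta} [|r theta rr _ IH]; first by rewrite id_lfunE.
by rewrite comp_lfunE; exact: zspan_reflection.
Qed.

End CartanIntegers.

(** * Finiteness of the center *)

Section CenterFinite.
Variables (R : realType) (S : lieSetup R) (D : rootSetup S).
Notation s_ := (tnth (simple D)).

Lemma n_c_int l : n_c D l \is a Num.int.
Proof.
rewrite /n_c !rpredD ?rpred1 ?rpred_nat //.
by have /asboolP := valP (rho D); apply; exact: rmax_root.
Qed.

(** The integer [n_c] multiplies combinations of Weyl images of the root [rmax], and reflections
    preserve the root lattice. *)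
Lemma levlat_rootlat l (x : weight S) : x \in levlat D l -> x \in rootlat S.
Proof.
move=> /asboolP[y zy xE]; apply/asboolP; rewrite xE.
have /intrP[m ->] := n_c_int l; rewrite scaler_int; apply: zspan_int.
elim: zy => {y xE} [|_ [theta th <-]|x' y _ hx _ hy].
- exact: zspan0.
- by apply: zspan_weyl => //; apply: zspan_gen; exact: rmax_root.
- exact: zspanB.
Qed.

Lemma simple_orth_eq0 (x : cartan S) : (forall j, ipt x (coroot (s_ j)) = 0) -> x = 0.
Proof.
move=> xs; apply/eqP/negPn/negP => /eqP/ipt_gt0.
rewrite {2}(coord_basis (simple_basis D) (memvf x)).
rewrite [X in ipt x X](_ : _ = \sum_i coord (simple D) i x *: s_ i); last first.
  by apply: eq_bigr => i _; rewrite (tnth_nth 0).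
suff -> : ipt x (\sum_i coord (simple D) i x *: s_ i) = 0 by rewrite ltxx.
elim/big_rec: _ => [|i y _ IH]; first exact: ipt0r.
rewrite iptDr IH iptZr addr0; have /eqP := xs i.
have c0 : 0 < ipt (s_ i) (s_ i) by apply: ipt_gt0; case: (simple_root D i).
rewrite /coroot iptZr mulf_eq0 gt_eqF ?divr_gt0 //= => /eqP ->.
by rewrite mulr0.
Qed.

(** The coefficients are the integers [<k, coroot s_j>]; the difference of both sides is then
    orthogonal to all simple coroots. *)
Lemma weight_fund (k : weight S) : exists c : 'I_(rank S) -> int,
  k = \sum_i fund D i *~ c i.
Proof.
have /choice[c cE] j : exists m : int, ipt (val k) (coroot (s_ j)) = m%:~R.
  by apply/intrP; have /asboolP := valP k; apply; exact: simple_root.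
exists c; apply: val_inj; apply/eqP; rewrite -subr_eq0; apply/eqP.
apply: simple_orth_eq0 => j; rewrite iptBl cE.
have -> : val (\sum_i fund D i *~ c i) = \sum_i (c i)%:~R *: val (fund D i).
  by rewrite raddf_sum; apply: eq_bigr => i _; rewrite raddfMz -scaler_int.
have iptD (F : 'I_(rank S) -> cartan S) y : ipt (\sum_i F i) y = \sum_i ipt (F i) y.
  by apply: (big_morph (fun x => ipt x y)) => [u v|]; [exact: iptDl|exact: ipt0l].
rewrite iptD (bigD1 j) //= big1 => [|i ij].
  by rewrite iptZl fundE eqxx mulr1 addr0 subrr.
by rewrite iptZl fundE (negPf ij) mulr0.
Qed.

(** The integer matrix [M] of the simple roots in terms of the fundamental weights has nonzero
    determinant, the simple roots being independent. By the adjugate identity, [\det M] times a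
    fundamental weight is an integer combination of simple roots. *)
Lemma fund_rootlat : exists2 N : nat, (0 < N)%N &
  forall j, fund D j *+ N \in rootlat S.
Proof.
have /choice[f fE] i : exists f : 'I_(rank S) -> int,
    s_ i = \sum_j val (fund D j) *~ f j.
  have /root_weight wi := simple_root D i.
  have [c /(congr1 val)] := weight_fund (Sub (s_ i) wi).
  by rewrite SubK raddf_sum => ->; exists c; apply: eq_bigr => j _; rewrite raddfMz.
pose M : 'M[int]_(rank S) := \matrix_(i, j) f i j.
have detM : \det M != 0.
  rewrite -(intr_eq0 R) -det_map_mx -unitfE -unitmxE -row_free_unit.
  apply: inj_row_free => v vM; apply/rowP => i; rewrite mxE.
  have /freeP := basis_free (simple_basis D); apply => {i}.
  transitivity (\sum_i v 0 i *: s_ i).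
    by apply: eq_bigr => i _; rewrite (tnth_nth 0).
  under eq_bigr do rewrite fE scaler_sumr; rewrite exchange_big big1 //= => j _.
  rewrite -[RHS](scale0r (val (fund D j))).
  have /rowP/(_ j) := vM; rewrite !mxE => <-; rewrite scaler_suml.
  by apply: eq_bigr => i _; rewrite !mxE -scaler_int scalerA.
have fN j : fund D j *~ \det M \in rootlat S.
  apply/asboolP; rewrite raddfMz.
  have -> : val (fund D j) *~ \det M = \sum_i s_ i *~ (\adj M) j i.
    transitivity (\sum_k val (fund D k) *~ (\adj M *m M) j k).
      rewrite mul_adj_mx (bigD1 j) //= big1 => [|k kj].
        by rewrite addr0 mxE eqxx mulr1n.
      by rewrite mxE eq_sym (negPf kj) mulr0n mulr0z.
    under [RHS]eq_bigr do rewrite fE mulrz_suml.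
    rewrite exchange_big; apply: eq_bigr => k _; rewrite mxE mulrz_sumr.
    by apply: eq_bigr => i _; rewrite [M _ _]mxE -mulrzA mulrC.
  elim/big_rec: _ => [|i x _ zx]; first exact: zspan0.
  by apply: zspanD zx; apply: zspan_int; apply: zspan_gen; exact: simple_root.
exists `|\det M|%N => [|j]; first by rewrite absz_gt0.
rewrite -[_ *+ _]/(fund D j *~ `|\det M|%N) abszEsign mulrC mulrzA.
by rewrite rpredMz.
Qed.

(** Reducing the coefficients of a weight modulo [N] changes it by an element of the root lattice,
    so the finitely many families of residues reach every class. *)
Lemma finite_centerZ : finite_set [set: centerZ S].
Proof.
have [N N0 fN] := fund_rootlat.
pose F (c : {ffun 'I_(rank S) -> 'I_N}) : centerZ S :=
  \pi_(centerZ S) (\sum_i fund D i *+ c i).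
apply: (@sub_finite_set _ _ (F @` setT)); last exact: finite_image.
move=> z _; rewrite -[z]reprK; have [c ->] := weight_fund (repr z).
have cN i : (`|(c i %% N)%Z|%N < N)%N.
  by rewrite -ltz_nat gez0_abs ?modz_ge0 ?ltz_pmod // gt_eqF.
exists [ffun i => Ordinal (cN i)] => //; apply/eqP; rewrite -Quotient.idealrBE.
rewrite -sumrB rpred_sum // => i _; rewrite ffunE /=.
rewrite {2}(divz_eq (c i) N) pmulrn gez0_abs ?modz_ge0 ?gt_eqF //.
rewrite -mulrzBr opprD addrCA subrr addr0 mulrNz rpredN mulrC mulrzA.
by rewrite rpredMz // -pmulrn.
Qed.

Lemma n_zE : n_z S = #|{: fset_set [set: centerZ S]}|.
Proof. by rewrite /n_z cardfE. Qed.

End CenterFinite.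

(** * Weights of an irreducible representation *)

Section Weights.
Variables (R : realType) (S : lieSetup R) (D : rootSetup S).

(** Weight vectors are joint eigenvectors of the torus, and distinct weights [s], [t] have distinct
    joint eigenvalues, as [H = s - t] shows; so their number is at most the dimension. *)
Lemma finite_weights w (V : irrep D w) : finite_set (weights V).
Proof.
apply: contrapT => /(infinite_set_fset (\dim {:irr_space V}).+1)[B BV].
rewrite cardfE leqNgt => /negP; apply; rewrite ltnS.
have /choice[v vP] (s : B) : exists v : irr_space V, v != 0 /\
    forall H, irr_act V (vsval H) v = ('i * (ipt (val (val s)) H)%:C%C) *: v.
  have [v [sv v0]] := sdim_gt0 (BV _ (valP s)).
  by exists v.
apply: (@joint_eigen_card _ _ (cartan S) (fun H => irr_act V (vsval H)) _
  (fun s H => 'i * (ipt (val (val s)) H)%:C%C) v) => [s t st|s H|s]; last 2 first.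
- by have [_] := vP s; exact.
- by have [] := vP s.
apply/val_inj/val_inj/eqP; rewrite -subr_eq0; apply/negPn/negP => /eqP/ipt_gt0.
rewrite iptBl; have /(mulfI (neq0Ci _))[->] := st (val (val s) - val (val t)).
by rewrite subrr ltxx.
Qed.

Lemma zspan_simple (c : 'I_(rank S) -> nat) :
  zspan (@is_root R S) (\sum_i tnth (simple D) i *+ c i).
Proof.
elim/big_rec: _ => [|i x _ zx]; first exact: zspan0.
apply: zspanD zx; rewrite pmulrn; apply/zspan_int/zspan_gen.
exact: simple_root.
Qed.

Lemma weights_rootlat (w : weight S) (V : irrep D (val w)) s :
  weights V s -> w - s \in rootlat S.
Proof.
move=> /sdim_gt0[v [sv /eqP v0]]; apply/asboolP; rewrite raddfB.
by have [c ->] := irr_lower v0 sv; exact: zspan_simple.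
Qed.

End Weights.

(** * The grading by Z(g) and its projections *)

Section Grading.
Variables (R : realType) (S : lieSetup R) (D : rootSetup S).
Notation Z := (fset_set [set: centerZ S]).

Lemma mem_centerZ a : a \in Z.
Proof. by rewrite in_fset_set ?in_setT //; exact: finite_centerZ D. Qed.

Lemma centerZ_reindex (V : nmodType) (h : centerZ S -> centerZ S) (F : centerZ S -> V) :
  injective h -> \sum_(a <- Z) F (h a) = \sum_(a <- Z) F a.
Proof.
move=> hI; rewrite -(big_map h xpredT).
have mZ : {subset [seq h a | a <- Z] <= Z} by move=> a _; exact: mem_centerZ.
have uZ : uniq [seq h a | a <- Z] by rewrite map_inj_uniq ?fset_uniq.
apply: perm_big; apply: uniq_perm; rewrite ?fset_uniq //.
by have [_] := uniq_min_size uZ mZ (eq_leq (esym (size_map _ _))).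
Qed.

(** The graded pieces are pairwise orthogonal with full sum; orthogonality makes the sum direct,
    which yields the projections. *)
Lemma gus_proj l (P : GUSrep D l) : exists p : centerZ S -> 'End(gus_space P),
  [/\ forall a v, p a v \in gus_grade P a,
      forall a b v, v \in gus_grade P b -> p a v = if a == b then v else 0 &
      forall v, \sum_(a <- Z) p a v = v].
Proof.
(* The list in [gus_grade_full] may repeat or omit degrees; the sum over all of Z(g) contains its
   sum. *)
have defV : fullv = (\sum_(a <- Z) gus_grade P a)%VS.
  have [s sE] := gus_grade_full P; apply/eqP; rewrite eq_sym eqEsubv subvf -sE.
  apply: (big_ind (fun U => (U <= \sum_(a <- Z) gus_grade P a)%VS)) => [|U W UZ WZ|a _].
  - exact: sub0v.
  - by rewrite subv_add UZ.
  - by rewrite (big_rem a (mem_centerZ a)) addvSl.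
pose p a : 'End(gus_space P) := sumv_pi_for defV a.
have pP a v : p a v \in gus_grade P a by exact: memv_sum_pi.
have sum_p v : \sum_(a <- Z) p a v = v.
  by apply: (sumv_pi_uniq_sum defV); rewrite ?memvf ?filter_uniq ?fset_uniq.
have p0 a b v : v \in gus_grade P b -> a != b -> p a v = 0.
  move=> vb ab; apply/eqP; apply/negPn/negP => /(neq0_dnorm_gt0 (s := gus_dot P)).
  (* Expanding [v] into the [p c v], only [c = a] pairs nontrivially with [p a v]; but [v], of
     degree [b], is orthogonal to degree [a], so [p a v] has norm 0. *)
  suff -> : gus_dot P (p a v) (p a v) = gus_dot P v (p a v).
    by rewrite (@gus_grade_orth _ _ _ _ P b a) ?ltxx //; apply/eqP; rewrite eq_sym.
  rewrite -[in X in _ = gus_dot P X _](sum_p v) linear_sumlz.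
  rewrite (big_rem a (mem_centerZ a)) /= [X in _ + X]big1_seq ?addr0 // => c /=.
  rewrite (rem_filter _ (fset_uniq _)) mem_filter => /andP[/= ca _].
  by apply: (@gus_grade_orth _ _ _ _ P c a) => //; exact/eqP.
exists p; split=> // a b v vb; case: eqVneq => [->|ab]; last exact: p0 vb ab.
rewrite -[RHS]sum_p (big_rem b (mem_centerZ b)) /= [X in _ + X]big1_seq ?addr0 // => c /=.
by rewrite (rem_filter _ (fset_uniq _)) mem_filter => /andP[/= cb _]; exact: p0 vb cb.
Qed.

End Grading.

(** * Quantum root spaces *)

Section Classes.
Variables (R : realType) (S : lieSetup R) (D : rootSetup S) (l : nat).
Notation W := (Wlev D l).
Notation pW := (piW D l).
Notation pZ := (\pi_(centerZ S)).

Lemma piWB j k : pW (j - k) = pW j - pW k.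
Proof. exact: raddfB. Qed.

Lemma piWD j k : pW (j + k) = pW j + pW k.
Proof. exact: raddfD. Qed.

Lemma piWN k : pW (- k) = - pW k.
Proof. exact: raddfN. Qed.

Lemma piZB j k : pZ (j - k) = pZ j - pZ k.
Proof. exact: raddfB. Qed.

Lemma piZ_eq j k : (pZ j == pZ k) = (j - k \in rootlat S).
Proof. by rewrite Quotient.idealrBE. Qed.

Lemma piW_eq j k : (pW j == pW k) = (j - k \in levlat D l).
Proof. by rewrite Quotient.idealrBE. Qed.

Lemma piW_repr (x : W) : pW (repr x) = x.
Proof. exact: reprK. Qed.

Definition cl (x : W) : centerZ S := pZ (repr x).

(** A weight and the chosen representative of its class differ by an element of [levlat], hence of
    the root lattice. *)
Lemma cl_piW k : cl (pW k) = pZ k.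
Proof.
by apply/eqP; rewrite piZ_eq (@levlat_rootlat _ _ D l) // -piW_eq piW_repr.
Qed.

Lemma clB x y : cl (x - y) = cl x - cl y.
Proof. by rewrite -{1}(piW_repr x) -{1}(piW_repr y) -piWB cl_piW piZB. Qed.

Lemma clD x y : cl (x + y) = cl x + cl y.
Proof. by rewrite -{1}(piW_repr x) -{1}(piW_repr y) -piWD cl_piW raddfD. Qed.

Lemma Rlev_cl x : Rlev D l x <-> cl x = 0.
Proof.
split=> [[r rr <-]|x0].
  by rewrite cl_piW; apply/eqP; rewrite -[0](raddf0 pZ) piZ_eq subr0.
exists (repr x); last exact: piW_repr.
by move/eqP: x0; rewrite -[0](raddf0 pZ) piZ_eq subr0.
Qed.

Lemma expiD (x y : R) : expi (x + y) = expi x * expi y.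
Proof. by rewrite /expi sinD cosD; congr (_ +i* _)%C; ring. Qed.

Lemma expi0 : expi (0 : R) = 1.
Proof. by rewrite /expi sin0 cos0. Qed.

Lemma char_D (j k : weight S) H :
  char (val (j + k)) (expT H) = char (val j) (expT H) * char (val k) (expT H).
Proof. by rewrite !charE raddfD iptDl expiD. Qed.

Lemma char_T (A : set (weight S)) (x : maxtorus S) (j : weight S) :
  T_ A x -> A j -> char (val j) x = 1.
Proof.
move=> [H AH <-] Aj; rewrite charE iptZr -[RHS]expi0 -[2 * pi * _]add0r.
exact: expi_periodic (AH _ Aj).
Qed.

Lemma char_expTD (j : weight S) H H' : char (val j) (expT (H + H'))
  = char (val j) (expT H) * char (val j) (expT H').
Proof. by rewrite !charE iptDr expiD. Qed.

End Classes.

(** * Equations and translations of the quantum root spaces *)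

Section RootSpaces.
Variables (R : realType) (S : lieSetup R) (D : rootSetup S).
Variables (V : forall i, irrep D (val (fund D i))) (l : nat) (P : GUSrep D l).
Notation W := (Wlev D l).
Notation pW := (piW D l).
Notation pZ := (\pi_(centerZ S)).
Notation Z := (fset_set [set: centerZ S]).
Notation wts i := (fset_set (weights (V i))).

Lemma DeltaE i (f : L2H P) k :
  Delta V i f k = \sum_(s <- wts i) (mult (V i) s)%:R *: f (k - pW s).
Proof. by rewrite /Delta fsbig_finite //; exact: finite_weights. Qed.

Lemma chiE i x : chi (V i) x = \sum_(s <- wts i) (mult (V i) s)%:R * char (val s) x.
Proof. by rewrite /chi fsbig_finite //; exact: finite_weights. Qed.

Lemma weights_cl i s : s \in wts i -> cl (pW s) = pZ (fund D i).
Proof.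
rewrite in_fset_set; last exact: finite_weights.
rewrite inE => /weights_rootlat; rewrite -piZ_eq => /eqP ->.
exact: cl_piW.
Qed.

Lemma rootspaceP (f : L2H P) :
  rootspace V f <-> forall i k, Delta V i f k = Pi_fund P i (f k).
Proof.
split=> [rf i k|rf i].
  by apply/eqP; rewrite -subr_eq0; apply/eqP; have := congr1 (@^~ k) (rf i).
by apply/funext => k; apply/eqP; rewrite subr_eq0; apply/eqP; exact: rf.
Qed.

Lemma rootspace0P (f : L2H P) : rootspace0 V f <->
  rootspace V f /\ forall x, f x \in gus_grade P (- cl x).
Proof.
split=> -[rf gf]; split=> //; last by move=> k; rewrite -(cl_piW D l).
by move=> x; have := gf (repr x); rewrite piW_repr.
Qed.

Lemma eigenP (A : set W) x (f : L2H P) : eigen A x f <->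
  forall j, A (pW j) -> forall k, f (k + pW j) = char (- val j) x *: f k.
Proof.
split=> [ef j Aj k|ef j Aj]; first by have := congr1 (@^~ k) (ef j Aj).
by apply/funext => k; exact: ef.
Qed.

Lemma L2HE a (f g : L2H P) k : (a *: f + g) k = a *: f k + g k.
Proof. by []. Qed.

Lemma rootspace_subspace : is_subspace (@rootspace R S D l V P).
Proof.
split=> [|a f g /rootspaceP rf /rootspaceP rg]; apply/rootspaceP => i k.
  by rewrite DeltaE big1 ?linear0 // => s _; rewrite scaler0.
rewrite L2HE linearP /= -rf -rg !DeltaE scaler_sumr -big_split.
by apply: eq_bigr => s _; rewrite L2HE scalerDr !scalerA mulrC.
Qed.

Lemma rootspace0_subspace : is_subspace (@rootspace0 R S D l V P).
Proof.
have [r0 rD] := rootspace_subspace; split=> [|a f g [rf gf] [rg gg]]; split.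
- exact: r0.
- by move=> k; exact: mem0v.
- exact: rD.
- by move=> k; rewrite L2HE memvD ?memvZ.
Qed.

Lemma eigen_subspace (A : set W) x : is_subspace (@eigen R S D l P A x).
Proof.
split=> [|a f g /eigenP ef /eigenP eg]; apply/eigenP => j Aj k.
  by rewrite [RHS]scaler0.
by rewrite !L2HE ef // eg // scalerDr !scalerA mulrC.
Qed.

(** The operator has index [fund D i + rho], and the degree shift subtracts [rho] again. *)
Lemma Pi_fund_grade i a v : v \in gus_grade P a ->
  Pi_fund P i v \in gus_grade P (a + pZ (fund D i)).
Proof.
move=> va; have /subvP := gus_Pi_grade P (fund D i + rho D) a.
by rewrite addrK; apply; exact: memv_img.
Qed.

Lemma translation_is_linear j : linear (@translation R S D l P j).
Proof. by move=> a f g; apply/funext => k; rewrite /translation L2HE. Qed.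
HB.instance Definition _ j := GRing.isLinear.Build R[i] (L2H P) (L2H P) _
  (@translation R S D l P j) (translation_is_linear j).

Lemma Delta_translation i j (f : L2H P) k :
  Delta V i (translation j f) k = Delta V i f (k + j).
Proof. by rewrite !DeltaE; apply: eq_bigr => s _; rewrite /translation addrAC. Qed.

Lemma rootspace_translation j (f : L2H P) :
  rootspace V f -> rootspace V (translation j f).
Proof.
by move=> /rootspaceP rf; apply/rootspaceP => i k; rewrite Delta_translation rf.
Qed.

Lemma eigen_translation (A : set W) x j (f : L2H P) :
  eigen A x f -> eigen A x (translation j f).
Proof.
move=> /eigenP ef; apply/eigenP => h Ah k.
by rewrite /translation addrAC ef.
Qed.

End RootSpaces.

(** * Decomposition according to the classes in Z(g) *)

Section Components.
Variables (R : realType) (S : lieSetup R) (D : rootSetup S).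
Variables (V : forall i, irrep D (val (fund D i))) (l : nat) (P : GUSrep D l).
Notation W := (Wlev D l).
Notation pW := (piW D l).
Notation pZ := (\pi_(centerZ S)).
Notation Z := (fset_set [set: centerZ S]).
Variable p : centerZ S -> 'End(gus_space P).
Hypothesis pP : forall a v, p a v \in gus_grade P a.
Hypothesis pE : forall a b v, v \in gus_grade P b -> p a v = if a == b then v else 0.
Hypothesis sum_p : forall v, \sum_(a <- Z) p a v = v.

Lemma proj_Pi_fund i a v : p (a + pZ (fund D i)) (Pi_fund P i v) = Pi_fund P i (p a v).
Proof.
rewrite -{1}(sum_p v) !linear_sum (big_rem a (mem_centerZ D a)) /=.
rewrite [X in _ + X]big1_seq => [|b /=].
  by rewrite addr0 (pE _ (Pi_fund_grade i (pP a v))) eqxx.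
rewrite (rem_filter _ (fset_uniq _)) mem_filter => /andP[/= ba _].
by rewrite (pE _ (Pi_fund_grade i (pP b v))) (inj_eq (addIr _)) eq_sym (negPf ba).
Qed.

Lemma proj_inj_sum (h : centerZ S -> centerZ S) v : injective h ->
  \sum_(a <- Z) p (h a) v = v.
Proof. by move=> /(centerZ_reindex D (fun a => p a v)) ->. Qed.

Lemma cl_repr a : cl (pW (repr a)) = a.
Proof. by rewrite cl_piW reprK. Qed.

(** The class [a] part of [f], made of the degree [a - cl k] parts of the values [f k], moved into
    class 0 by translation by a representative of [a]. *)
Definition component (a : centerZ S) (f : L2H P) : L2H P :=
  fun x => p (- cl x) (f (x + pW (repr a))).

Lemma component_is_linear a : linear (component a).
Proof. by move=> c f g; apply/funext => x; rewrite /component !L2HE linearP. Qed.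
HB.instance Definition _ a := GRing.isLinear.Build R[i] (L2H P) (L2H P) _
  (component a) (component_is_linear a).

(** All weights [s] of [V i] have the class of [fund D i], so the projection index [- cl (x - s)] is
    the same in every term of [Delta]: the degree [- cl x], shifted as [Pi_fund i] shifts it. *)
Lemma rootspace0_component a f : rootspace V f -> rootspace0 V (component a f).
Proof.
move=> /rootspaceP rf; apply/rootspace0P; split=> [|x]; last exact: pP.
apply/rootspaceP => i x; rewrite -proj_Pi_fund -rf !DeltaE linear_sum.
apply: eq_big_seq => s ws; rewrite linearZ /= /component.
by rewrite clB opprB (weights_cl l ws) [- _ + _]addrC addrAC.
Qed.

(** Elements of [A] have class 0, so translating by them leaves the projection index [- cl x]
    unchanged. *)
Lemma eigen_component (A : set W) x a (f : L2H P) : A `<=` Rlev D l ->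
  eigen A x f -> eigen A x (component a f).
Proof.
move=> AR /eigenP ef; apply/eigenP => j Aj k.
have /Rlev_cl cj := AR _ Aj.
by rewrite /component clD cj addr0 addrAC (ef j Aj) linearZ.
Qed.

(** The translation puts class 0 into class [a], while [component b] retains class [b] and moves it
    back. *)
Lemma component_translation (a b : centerZ S) (f : L2H P) : rootspace0 V f ->
  component b (translation (- pW (repr a)) f) = if a == b then f else 0.
Proof.
move=> /rootspace0P[_ gf]; apply/funext => x; rewrite /component /translation.
rewrite (pE _ (gf _)) clB clD !cl_repr eq_sym eqr_opp -addrA -[in X in _ == X](addr0 (cl x)).
rewrite (inj_eq (addrI _)) subr_eq0 eq_sym.
by case: eqP => [->|//]; rewrite addrK.
Qed.

(** The two translations cancel, so at [x] the term of [a] is [p (a - cl x) (f x)]; as [a] varies,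
    every degree occurs once. *)
Lemma sum_component (f : L2H P) :
  f = \sum_(a <- Z) translation (- pW (repr a)) (component a f).
Proof.
apply/funext => x; rewrite (big_morph (fun f : L2H P => f x) (id1 := 0) (op1 := +%R)) //.
under eq_bigr do rewrite /translation /component subrK clB cl_repr opprB.
by rewrite proj_inj_sum //; exact: addIr.
Qed.

Lemma m_A_copies (A : set W) x : A `<=` Rlev D l ->
  m_A V P A x = (n_z S * m_A0 V P A x)%N.
Proof.
move=> AR; rewrite n_zE.
pose u (a : Z) : {linear L2H P -> L2H P} := translation (- pW (repr (val a))).
pose q (a : Z) : {linear L2H P -> L2H P} := component (val a).
apply: (@sdim_copies _ _ _ _ _ u q).
- by apply: subspaceI; [exact: rootspace_subspace|exact: eigen_subspace].
- by apply: subspaceI; [exact: rootspace0_subspace|exact: eigen_subspace].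
- by apply/card_gt0P; exists [` mem_centerZ D 0]%fset.
- move=> a f [[rf _] ef]; split; first exact: rootspace_translation.
  exact: eigen_translation.
- move=> a f [rf ef]; split; first exact: rootspace0_component.
  exact: eigen_component.
- by move=> a b f [rf _]; rewrite -val_eqE; exact: component_translation.
- by move=> f _; rewrite {1}(sum_component f) big_seq_fsetE.
Qed.

(** * Eigenvectors for the full root lattice *)

Section FullRootLattice.
Variable H : cartan S.
Hypothesis TH : T_lev D l (expT H).

(** The character of [Wlev] induced by [e^H]; the representative is immaterial because [e^H] in
    [T_lev] is trivial on [levlat]. *)
Definition wchar (x : W) : R[i] := char (val (repr x)) (expT H).

Lemma wchar_piW k : wchar (pW k) = char (val k) (expT H).
Proof.
rewrite /wchar -[repr _](subrK k) char_D (char_T TH) ?mul1r //=.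
by rewrite -piW_eq piW_repr.
Qed.

Lemma wcharD x y : wchar (x + y) = wchar x * wchar y.
Proof. by rewrite -[in LHS](piW_repr x) -[in LHS](piW_repr y) -piWD wchar_piW char_D. Qed.

Lemma wchar0 : wchar 0 = 1.
Proof. by rewrite -[0](raddf0 pW) wchar_piW charE raddf0 ipt0l expi0. Qed.

Lemma wcharN x : wchar (- x) * wchar x = 1.
Proof. by rewrite -wcharD addNr wchar0. Qed.

Lemma chi_wchar i : chi (V i) (expT H) =
  \sum_(s <- fset_set (weights (V i))) (mult (V i) s)%:R * wchar (pW s).
Proof. by rewrite chiE; apply: eq_bigr => s _; rewrite wchar_piW. Qed.

(** Points of one class differ by some [j] in the root lattice, and translation by [j] multiplies
    [f] by the inverse of [wchar] at [j]. *)
Lemma eigen_RlevP (f : L2H P) : eigen (Rlev D l) (expT H) f ->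
  forall x y, cl x = cl y -> wchar x *: f x = wchar y *: f y.
Proof.
move=> /eigenP ef x y xy; pose j := repr (x - y).
have Rj : Rlev D l (pW j) by apply/Rlev_cl; rewrite piW_repr clB xy subrr.
have := ef j Rj y; rewrite piW_repr addrC subrK => ->.
rewrite scalerA -raddfN -wchar_piW piWN piW_repr opprB -wcharD.
by rewrite addrC subrK.
Qed.

Definition gather (f : L2H P) : gus_space P :=
  \sum_(a <- Z) wchar (pW (repr a)) *: f (pW (repr a)).

Lemma gather_is_linear : linear gather.
Proof.
move=> c f g; rewrite /gather scaler_sumr -big_split; apply: eq_bigr => a _.
by rewrite L2HE scalerDr !scalerA mulrC.
Qed.
HB.instance Definition _ := GRing.isLinear.Build R[i] (L2H P) (gus_space P) _
  gather gather_is_linear.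

(** Inverse to [gather] on class 0 eigenvectors: the degree [- cl x] part of [v], twisted by the
    inverse character. *)
Definition spread (v : gus_space P) : L2H P := fun x => wchar (- x) *: p (- cl x) v.

Lemma spread_is_linear : linear spread.
Proof.
move=> c v w; apply/funext => x; rewrite L2HE /spread linearP scalerDr !scalerA.
by rewrite mulrC.
Qed.
HB.instance Definition _ := GRing.isLinear.Build R[i] (gus_space P) (L2H P) _
  spread spread_is_linear.

Definition chi_eigen : set (gus_space P) :=
  [set v | forall i, Pi_fund P i v = chi (V i) (expT H) *: v].

(** In class 0 the summand of [gather f] at [a] has degree [- a], so projecting to degree [- cl x]
    leaves the summand at [cl x], which is [wchar x *: f x]. *)
Lemma gatherK f : rootspace0 V f -> eigen (Rlev D l) (expT H) f ->
  spread (gather f) = f.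
Proof.
move=> /rootspace0P[_ gf] /eigen_RlevP ef; apply/funext => x; rewrite /spread /gather.
rewrite linear_sum (big_rem (cl x) (mem_centerZ D _)) /= [X in _ + X]big1_seq => [|a /=].
  rewrite addr0 linearZ /= (pE _ (gf _)) cl_repr eqxx (ef _ x) ?cl_repr //.
  by rewrite scalerA wcharN scale1r.
rewrite (rem_filter _ (fset_uniq _)) mem_filter => /andP[/= ba _].
by rewrite linearZ /= (pE _ (gf _)) cl_repr eqr_opp eq_sym (negPf ba) scaler0.
Qed.

Lemma spreadK v : gather (spread v) = v.
Proof.
rewrite /gather /spread -[RHS](proj_inj_sum v (@oppr_inj _)); apply: eq_bigr => a _.
by rewrite scalerA mulrC wcharN scale1r cl_repr.
Qed.

(** In [Delta] the weight [s] contributes its multiplicity times [wchar (pW s)] times a vector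
    independent of [s]; these factors add up to [chi]. *)
Lemma rootspace0_spread v : chi_eigen v -> rootspace0 V (spread v).
Proof.
move=> ve; apply/rootspace0P; split=> [|x]; last by rewrite memvZ.
apply/rootspaceP => i x; rewrite [in RHS]/spread linearZ /= -proj_Pi_fund ve linearZ /=.
rewrite scalerA chi_wchar mulr_sumr scaler_suml DeltaE; apply: eq_big_seq => s ws.
rewrite /spread clB opprB (weights_cl l ws) [- cl x + _]addrC scalerA.
by rewrite opprB wcharD; congr (_ *: _); ring.
Qed.

Lemma eigen_spread v : eigen (Rlev D l) (expT H) (spread v).
Proof.
apply/eigenP => j Rj x; have /Rlev_cl cj := Rj.
rewrite /spread clD cj addr0 scalerA -[- val j]raddfN -wchar_piW piWN -wcharD.
by rewrite opprD addrC.
Qed.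

(** Let [G a] be the common value of [wchar x *: f x] on class [a]. The root space equation
    expresses [Pi_fund i (G a)] by [G] at [a] minus the class of [fund D i]; in the sum over [a]
    this shift only permutes the terms, and [chi] factors out. *)
Lemma chi_eigen_gather f : rootspace0 V f -> eigen (Rlev D l) (expT H) f ->
  chi_eigen (gather f).
Proof.
move=> [/rootspaceP rf _] /eigen_RlevP ef i.
pose G (a : centerZ S) := wchar (pW (repr a)) *: f (pW (repr a)).
have GE x : wchar x *: f x = G (cl x) by apply: ef; rewrite cl_repr.
rewrite /gather linear_sum chi_wchar.
transitivity (\sum_(a <- Z) \sum_(s <- fset_set (weights (V i)))
    ((mult (V i) s)%:R * wchar (pW s)) *: G (a - pZ (fund D i))).
  apply: eq_bigr => a _; rewrite linearZ /= -rf DeltaE scaler_sumr.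
  apply: eq_big_seq => s ws; rewrite -(weights_cl l ws) -[in G _](cl_repr a) -clB -GE.
  by rewrite !scalerA; congr (_ *: _); rewrite -mulrA -wcharD addrC subrK mulrC.
under eq_bigr do rewrite -scaler_suml.
by rewrite -scaler_sumr (centerZ_reindex D G (@addIr _ _)).
Qed.

Lemma m_A0_Rlev : m_A0 V P (Rlev D l) (expT H) = m_Pi V P (expT H).
Proof.
apply: (@sdim_iso _ _ _ _ chi_eigen gather spread).
- by apply: subspaceI; [exact: rootspace0_subspace|exact: eigen_subspace].
- split=> [i|c v w ve we i]; first by rewrite linear0 scaler0.
  by rewrite linearP /= ve we scalerDr !scalerA mulrC.
- by move=> f [rf ef]; exact: chi_eigen_gather.
- by move=> v ve; split; [exact: rootspace0_spread|exact: eigen_spread].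
- by move=> f [rf ef]; exact: gatherK.
- by move=> v _; exact: spreadK.
Qed.

End FullRootLattice.
End Components.

Theorem theorem8p24 (R : realType) (S : lieSetup R) (D : rootSetup S)
  (V : forall i, irrep D (val (fund D i)))
  (l : nat) (P : GUSrep D l)
  (A : set (Wlev D l)) (A_subgroup : subgroup A) (A_sub : A `<=` Rlev D l) :
  (forall H H' : cartan S,
    T_lev0 D l (expT H) -> T_ [set r | r \in rootlat S] (expT H') ->
    m_A V P A (expT H) = m_A V P A (expT (H + H')) /\
    m_A V P A (expT (H + H')) = (n_z S * m_A0 V P A (expT H))%N) /\
  (forall H : cartan S, T_lev0 D l (expT H) ->
    m_A0 V P (Rlev D l) (expT H) = m_Pi V P (expT H)).
Proof.
have [p [pP pE sum_p]] := gus_proj P; split=> [H H' _ TH'|H [H0 [TH _] HE]]; last first.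
  by apply: (m_A0_Rlev V pP pE sum_p); rewrite -HE.
(* The eigenvalue conditions at [H] and [H + H'] coincide: [A] comes from the root lattice, on which
   [e^{H'}] is trivial. *)
suff eE : @eigen R S D l P A (expT (H + H')) = eigen A (expT H).
  by rewrite /m_A eE; split=> //; exact: (m_A_copies V pP pE sum_p).
have cE j : A (piW D l j) -> char (- val j) (expT (H + H')) = char (- val j) (expT H).
  move=> Aj; rewrite -raddfN char_expTD (char_T TH') ?mulr1 //= rpredN.
  have /Rlev_cl := A_sub _ Aj; rewrite cl_piW => /eqP.
  by rewrite -[0](raddf0 (\pi_(centerZ S))) piZ_eq subr0.
by apply/seteqP; split=> f /eigenP ef; apply/eigenP => j Aj k; rewrite ef // cE.
Qed.
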